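(* There exist an absolute constant $C>0$ and a sequence $(\delta_k)_{k\ge 2}$ of real numbers with $\delta_k\to 0$ as $k\to\infty$ such that for all integers $n\ge k\ge 2$, all but at most a $\delta_k$ fraction of the $k$-juntas $f:\mathbb{Z}_2^n\to\mathbb{Z}_2$ are $q$-locally correctable for $\varepsilon=0.001$ by an algorithm using $q\le C\,k\log^2 k$ non-adaptive queries.
   Context: For $f:\mathbb{Z}_2^n\to\mathbb{Z}_2$ and a permutation $\sigma\in\mathcal{S}_n$, let $f_\sigma(x_1,\dots,x_n)=f(x_{\sigma(1)},\dots,x_{\sigma(n)})$; such an $f_\sigma$ is called an isomorphism of $f$. Two functions $f,g:\mathbb{Z}_2^n\to\mathbb{Z}_2$ are $\varepsilon$-close if $\Pr_x[f(x)\ne g(x)]\le\varepsilon$ for uniformly random $x\in\mathbb{Z}_2^n$. Local correction: $f$ (known to the algorithm) is $q$-locally correctable for $\varepsilon>0$ if there is a randomized algorithm which, for every $\sigma\in\mathcal{S}_n$, every $g$ that is $\varepsilon$-close to $f_\sigma$, and every $x\in\mathbb{Z}_2^n$, given $x$ and black-box (query) access to $g$ (but not $\sigma$), outputs $f_\sigma(x)$ with probability at least $2/3$ using at most $q$ queries to $g$. The algorithm is non-adaptive if its query points do not depend on answers to earlier queries (they may depend on $f$, on $x$ and on the algorithm's randomness). No restriction is put on computation time. A $k$-junta is a function depending only on (at most) $k$ of its input variables. Its core $f_{\mathrm{core}}:\mathbb{Z}_2^k\to\mathbb{Z}_2$ is $f$ viewed as a function of its $k$ junta variables in their natural order. Local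 correctability is invariant under isomorphism of $f$, and the fraction of $k$-juntas having a property is measured by choosing the core uniformly at random among all functions $\mathbb{Z}_2^k\to\mathbb{Z}_2$ (with a fixed set of $k$ junta variables). *)

(* Defs.v *)
From HB Require Import structures.
From mathcomp Require Import all_boot all_order all_algebra all_fingroup.
From mathcomp Require Import boolp reals topology normedtype sequences exp.

Set Implicit Arguments.
Unset Strict Implicit.
Unset Printing Implicit Defensive.

Import Order.TTheory GRing.Theory Num.Theory.
Import numFieldNormedType.Exports.

Local Open Scope ring_scope.

Notation cube n := {ffun 'I_n -> 'Z_2}.
Notation boolfun n := {ffun cube n -> 'Z_2}.

Definition isomorph (n : nat) (f : boolfun n) (s : 'S_n) : boolfun n :=
  [ffun x : cube n => f [ffun i => x (s i)]].

Definition close (R : realType) (n : nat) (eps : R) (f g : boolfun n) : Prop :=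
  #|[pred x : cube n | f x != g x]|%:R / #|{: cube n}|%:R <= eps.

(* The query points are a function of the random seed and of the input alone;
   only the output sees the answers, listed in the order of the queries.
   Since there are finitely many query points, finite seed spaces with arbitrary
   real weights already realize every output distribution that a general
   probability space could. *)
Record nonadaptive_alg (R : realType) (n q : nat) := NonadaptiveAlg {
  seed : finType;
  weight : seed -> R;
  weight_ge0 : forall w, 0 <= weight w;
  weight_sum1 : \sum_w weight w = 1;
  queries : seed -> cube n -> seq (cube n);
  size_queries : forall w x, (size (queries w x) <= q)%N;
  output : seed -> cube n -> seq 'Z_2 -> 'Z_2
}.

Definition run (R : realType) (n q : nat) (A : nonadaptive_alg R n q)
    (g : boolfun n) (x : cube n) (w : seed A) : 'Z_2 :=
  output w x [seq g y | y <- queries w x].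

Definition prob_output (R : realType) (n q : nat) (A : nonadaptive_alg R n q)
    (g : boolfun n) (x : cube n) (b : 'Z_2) : R :=
  \sum_(w : seed A | run g x w == b) weight w.

(* The algorithm is chosen after f, and before s, g and x. *)
Definition nonadaptively_locally_correctable (R : realType) (n : nat)
    (eps : R) (q : nat) (f : boolfun n) : Prop :=
  exists A : nonadaptive_alg R n q,
    forall (s : 'S_n) (g : boolfun n), close eps g (isomorph f s) ->
    forall x : cube n, 2 / 3 <= prob_output A g x (isomorph f s x).

(* v lists the junta variables; it is meant to be strictly increasing, so that
   c is the core of the junta with respect to the natural order. *)
Definition junta (k n : nat) (v : 'I_k -> 'I_n) (c : boolfun k) : boolfun n :=
  [ffun x : cube n => c [ffun i => x (v i)]].

Definition core_fraction (R : realType) (k : nat) (P : boolfun k -> Prop) : R :=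
  #|[pred c : boolfun k | `[< P c >]]|%:R / #|{: boolfun k}|%:R.

(* Main.v *)
(* Cut [n] at random into [s = 16 k^2] parts by [h : 'I_n -> 'I_s], and refine
   the parts by the bits of [x], so that [x] is constant on each part.  With a
   random [w] and a random bit [z l] for every part [l], the point with
   coordinates [z (h i, x i) + w i] is uniform, so few of the query answers are
   corrupted.  On such points the unknown function is the core read through a
   candidate [tau], which gives the part and the bit of [w] of every junta
   variable; there are only [(64 k^2)^k = 2^O(k log k)] candidates, and [tau]
   determines [f_sigma x].  For most cores, two candidates with different parts
   disagree on at least 1/8 of the labellings [z], so [O(k log k)] random
   labellings leave only candidates that predict [f_sigma x] correctly.  The
   exceptional cores have a doubly exponentially small density, because
   translating [z] along the parts of the junta variables yields exponentially
   many independent tests. *)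

Require Import Defs.
From HB Require Import structures.
From mathcomp Require Import all_boot all_order all_algebra all_fingroup.
From mathcomp Require Import boolp reals topology normedtype sequences exp.
From mathcomp Require Import lra zify ring.

Set Implicit Arguments.
Unset Strict Implicit.
Unset Printing Implicit Defensive.

Import Order.TTheory GRing.Theory Num.Theory.
Import numFieldNormedType.Exports.

Local Open Scope classical_set_scope.
Local Open Scope ring_scope.

(** * Union bound and lower tails by counting *)

Lemma card_exists_le (A B : finType) (P : A -> pred B) :
  (#|[pred b | [exists a, P a b]]| <= \sum_a #|P a|)%N.
Proof.
rewrite -sum1_card; under [leqRHS]eq_bigr => a _ do rewrite -sum1_card.
rewrite (exchange_big_dep predT) //= [leqLHS]big_mkcond /=.
apply: leq_sum => b _; rewrite inE; case: ifP => // /existsP[a Pab].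
by rewrite (bigD1 a) /=.
Qed.

(* Markov's inequality for 2 ^- #|[pred i | D i (f i)]|. *)
Lemma lower_tail (F : realFieldType) (I T : finType) (D : I -> pred T) (a : nat) :
  #|[pred f : {ffun I -> T} | (#|[pred i | D i (f i)]| <= a)%N]|%:R
    <= 2 ^+ a * \prod_i (#|T|%:R - #|D i|%:R / 2) :> F.
Proof.
have -> : \prod_i (#|T|%:R - #|D i|%:R / 2) =
    \sum_(f : {ffun I -> T}) 2^-1 ^+ #|[pred i | D i (f i)]| :> F.
  have E i : #|T|%:R - #|D i|%:R / 2 = \sum_t (if D i t then 2^-1 else 1) :> F.
    have -> : #|T|%:R = \sum_(t : T) 1 :> F by rewrite sumr_const.
    have -> : #|D i|%:R = \sum_(t | D i t) 1 :> F by rewrite sumr_const.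
    rewrite mulr_suml [X in _ - X]big_mkcond -sumrB.
    by apply: eq_bigr => t _; case: ifP => _; lra.
  under eq_bigr => i _ do rewrite E.
  rewrite bigA_distr_bigA; apply: eq_bigr => f _.
  by rewrite -big_mkcond /= prodr_const.
rewrite -sum1_card natr_sum mulr_sumr big_mkcond /=.
apply: ler_sum => f _; rewrite inE; case: ifP => le_a.
  rewrite -(subnK le_a) exprD -mulrA -exprMn divff ?pnatr_eq0 // expr1n mulr1.
  by rewrite exprn_ege1 // ler1n.
by rewrite mulr_ge0 ?exprn_ge0 // invr_ge0.
Qed.

(** Each [v] in [A] tosses a fair coin, and 3/4 is the mean of the weight 1 or 1/2 given to its
    outcome. The coins are independent because [c (phi v)] is fresh for every [v]: [phi] is
    injective on [A] and avoids the values of [psi]. *)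
Lemma few_disagreements (F : realFieldType) (V X : finType) (A : {set V})
    (phi psi : V -> X) (a : nat) :
  {in A &, injective phi} ->
  {in A &, forall v v', phi v != psi v'} ->
  #|[pred c : {ffun X -> 'Z_2} |
      (#|[pred v in A | c (phi v) != c (psi v)]| <= a)%N]|%:R
    <= 2 ^+ a * (3 / 4) ^+ #|A| * #|{ffun X -> 'Z_2}|%:R :> F.
Proof.
move=> phi_inj disj.
have addZ2 (b : 'Z_2) : b + b = 0 by case: b => [[|[|[]]] //] ?; apply: val_inj.
have addZ2_eq0 (b b' : 'Z_2) : (b + b' == 0) = (b == b').
  by rewrite -{1}(addZ2 b') (inj_eq (addIr _)).
(* Recolouring phi v by c (phi v) + c (psi v) makes the disagreements
   independent. *)
pose r (c : {ffun X -> 'Z_2}) : {ffun X -> 'Z_2} :=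
  [ffun x => c x + \sum_(v in A | phi v == x) c (psi v)].
have r_psi c v : v \in A -> r c (psi v) = c (psi v).
  move=> Av; rewrite ffunE big_pred0 ?addr0 // => v'.
  by apply/negP => /andP[Av' /eqP e]; have := disj _ _ Av' Av; rewrite e eqxx.
have rK : involutive r.
  move=> c; apply/ffunP => x; rewrite [LHS]ffunE.
  rewrite (eq_bigr (fun v => c (psi v))) => [|v /andP[Av _]]; last exact: r_psi.
  by rewrite ffunE -addrA addZ2 addr0.
have r_phi c v : v \in A -> r c (phi v) = c (phi v) + c (psi v).
  move=> Av; rewrite ffunE (bigD1 v) ?Av ?eqxx //= big1 ?addr0 // => v'.
  by move=> /andP[/andP[Av' /eqP e]] /eqP[]; apply: phi_inj.
pose D (x : X) : pred 'Z_2 := fun b => (x \in phi @: A) && (b != 0).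
have -> : #|[pred c : {ffun X -> 'Z_2} |
      (#|[pred v in A | c (phi v) != c (psi v)]| <= a)%N]| =
    #|[pred c : {ffun X -> 'Z_2} | (#|[pred x | D x (c x)]| <= a)%N]|.
  rewrite -(card_image (inv_inj rK)).
  have E (c : {ffun X -> 'Z_2}) : #|[pred v in A | c (phi v) != c (psi v)]| =
      #|[pred x | D x (r c x)]|.
    rewrite -(card_in_image (f := phi) (A := [pred v in A | c (phi v) != c (psi v)])).
      apply: eq_card => x; rewrite [RHS]inE /D; apply/imageP/andP.
        case=> v; rewrite inE => /andP[Av ne] ->; split; first exact: imset_f.
        by rewrite r_phi // addZ2_eq0.
      case=> /imsetP[v Av ->]; rewrite r_phi // => ne; exists v => //.
      by rewrite inE Av /=; rewrite addZ2_eq0 in ne.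
    by move=> v v' /andP[Av _] /andP[Av' _]; apply: phi_inj.
  apply: eq_card => c; rewrite [RHS]inE; apply/imageP/idP.
    by case=> c'; rewrite inE E => ? ->.
  by move=> le_a; exists (r c); rewrite ?rK // inE E rK.
apply: (le_trans (lower_tail F D a)); rewrite -mulrA ler_wpM2l ?exprn_ge0 //.
have card_D x : #|D x| = (x \in phi @: A).
  case: (boolP (x \in phi @: A)) => Ax; last first.
    by apply: eq_card0 => b; rewrite inE /D (negPf Ax).
  rewrite (eq_card (B := pred1 1)) ?card1 // => b; rewrite inE /D Ax /=.
  by case: b => [[|[|[]]] //].
rewrite card_ffun card_ord natrX -(card_in_imset phi_inj).
have -> : (Zp_trunc 2).+2%:R = 2 :> F by [].
rewrite -(prodr_const (mem X)) -[X in _ * X](big_mkcond xpredT)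
  -(prodr_const (mem (phi @: A))) [X in _ <= X * _]big_mkcond.
rewrite -big_split /=; apply: ler_prod => x _; rewrite card_D.
by case: (x \in _) => /=; rewrite -[(Zp_trunc 2).+2%:R]/(2 : F); apply/andP; split; lra.
Qed.

(** * Most cores separate the candidates *)

Section Candidates.

Variables (k : nat) (T : finType).

(** A candidate gives each core variable a label in [T] (later a part together with a bit of x) and
    a bit of w. *)
Let cand : finType := {ffun 'I_k -> T * 'Z_2}.

Definition cand_point (tau : cand) (z : {ffun T -> 'Z_2}) : cube k :=
  [ffun i => z (tau i).1 + (tau i).2].

Definition spread (tau : cand) (e : cube k) : {ffun T -> 'Z_2} :=
  [ffun l => \sum_(j | (tau j).1 == l) e j].

(** With [a] and [b] the labels of one coordinate under two candidates, shifts along these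
    directions leave that coordinate of both points unchanged. *)
Definition free_dirs (tau : cand) (a b : T) : {set cube k} :=
  [set e : cube k | [forall j, ((tau j).1 \in [:: a; b]) ==> (e j == 0)]].

Lemma cand_point_spread (tau : cand) z e : injective (fun i => (tau i).1) ->
  cand_point tau (z + spread tau e) = cand_point tau z + e.
Proof.
move=> tau_inj; apply/ffunP => i; rewrite !ffunE.
rewrite (big_pred1 i) => [|j]; last by rewrite (inj_eq tau_inj).
by rewrite addrAC.
Qed.

Lemma spread_free (tau : cand) a b e l : e \in free_dirs tau a b ->
  l \in [:: a; b] -> spread tau e l = 0.
Proof.
rewrite inE => /forallP free_e ab_l; rewrite ffunE big1 // => j /eqP tau_j.
by apply/eqP; apply: (implyP (free_e j)); rewrite tau_j.
Qed.

Lemma cand_point_free (tau tau' : cand) a b z e i : e \in free_dirs tau a b ->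
  (tau' i).1 \in [:: a; b] -> cand_point tau' (z + spread tau e) i = cand_point tau' z i.
Proof.
by move=> free_e ab_i; rewrite 2!ffunE (spread_free free_e ab_i) addr0 [RHS]ffunE.
Qed.

(** As labels are distinct, at most two coordinates are forced to 0; the others are free. *)
Lemma card_free_dirs (tau : cand) a b : injective (fun i => (tau i).1) ->
  exists2 r, (k <= r + 2)%N & #|free_dirs tau a b| = (2 ^ r)%N.
Proof.
move=> tau_inj; pose F j : pred 'Z_2 :=
  if (tau j).1 \in [:: a; b] then pred1 0 else predT.
exists #|[pred j | (tau j).1 \notin [:: a; b]]|.
  have: (#|[pred j | (tau j).1 \in [:: a; b]]| <= 2)%N.
    rewrite -(card_image (f := fun j => (tau j).1)) //.
    apply: (leq_trans (n := #|[:: a; b]|)); last exact: card_size.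
    by apply: subset_leq_card; apply/subsetP => l /imageP[j ? ->].
  have := cardC [pred j | (tau j).1 \in [:: a; b]]; rewrite card_ord => E le2.
  by apply: (leq_trans (eq_leq (esym E))); rewrite addnC leq_add2l.
rewrite (eq_card (B := family F)) => [|e].
  rewrite card_family -prod_nat_const [RHS]big_mkcond foldrE big_map big_enum /=.
  apply: eq_bigr => j _; rewrite inE /F.
  by case: ifP => _ /=; [exact: card1 | rewrite cardT size_enum_ord].
rewrite inE; apply/forallP/familyP => free_e j.
  by have := free_e j; rewrite /F; case: ifP.
by have := free_e j; rewrite /F; case: ifP.
Qed.

(** [tau] stands for the true candidate and [tau'] for any rival that a decoder may pick. *)
Definition separating (c : boolfun k) : bool :=
  [forall tau : cand, forall tau' : cand, forall i,
    injectiveb (fun j => (tau j).1) && ((tau i).1 != (tau' i).1) ==>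
    (#|{ffun T -> 'Z_2}|
      <= 8 * #|[pred z | c (cand_point tau z) != c (cand_point tau' z)]|)%N].

(* The points tested on the tau side differ in coordinate i from all those
   tested on the tau' side, so for a random c the tests are independent. *)
Definition few_tests (c : boolfun k) (tau tau' : cand) (i : 'I_k)
    (z : {ffun T -> 'Z_2}) : bool :=
  let A := free_dirs tau (tau i).1 (tau' i).1 in
  [&& injectiveb (fun j => (tau j).1), cand_point tau z i != cand_point tau' z i &
   (4 * #|[pred e in A | c (cand_point tau (z + spread tau e)%R) !=
       c (cand_point tau' (z + spread tau e)%R)]| < #|A|)%N].

Lemma Z2_neqP (x y : 'Z_2) : (x != y) = (x == y + 1).
Proof.
by case: x => [[|[|[]]] //] ?; case: y => [[|[|[]]] //] ?.
Qed.

(** At least half of the labellings make coordinate [i] differ, and the free shifts preserve this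
    set. If each of its members saw a disagreement on a quarter of its shifts, averaging would give
    disagreement on 1/2 * 1/4 = 1/8 of all labellings. *)
Lemma separating_few_tests (c : boolfun k) :
  ~~ separating c ->
  [exists t : (cand * cand) * ('I_k * {ffun T -> 'Z_2}),
    few_tests c t.1.1 t.1.2 t.2.1 t.2.2].
Proof.
move=> /forallPn[tau /forallPn[tau' /forallPn[i]]].
rewrite negb_imply => /andP[/andP[inj_tau ne_i]]; apply: contraNT.
move=> /existsPn no_few.
have tau_inj := injectiveP _ inj_tau.
set A := free_dirs tau (tau i).1 (tau' i).1.
pose Z' := [pred z : {ffun T -> 'Z_2} | cand_point tau z i != cand_point tau' z i].
pose dis z := c (cand_point tau z) != c (cand_point tau' z).
have Z'_spread z e : e \in A -> (z + spread tau e \in Z') = (z \in Z').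
  by move=> Ae; rewrite !inE !(cand_point_free _ Ae) ?inE ?eqxx ?orbT.
have [r _ cardA] := card_free_dirs (tau i).1 (tau' i).1 tau_inj.
have A_gt0 : (0 < #|A|)%N by rewrite cardA expn_gt0.
(* Adding 1 at the label of [i] under [tau] flips coordinate [i] for [tau] but not for [tau'], so it
   maps the complement of [Z'] into [Z']. *)
have half : (#|{ffun T -> 'Z_2}| <= 2 * #|Z'|)%N.
  pose d : {ffun T -> 'Z_2} := [ffun l => (l == (tau i).1)%:R].
  rewrite mul2n -addnn -(cardC Z') leq_add2l.
  rewrite -(card_image (f := fun z : {ffun T -> 'Z_2} => z + d)); last exact: addIr.
  apply: subset_leq_card; apply/subsetP => _ /imageP[z nZ'z ->].
  move: nZ'z; rewrite !inE !ffunE eqxx (negPf (_ : (tau' i).1 != (tau i).1));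
    last by rewrite eq_sym.
  by rewrite negbK addr0 addrAC Z2_neqP => /eqP ->.
have swap e : e \in A ->
    (\sum_(z in Z') dis (z + spread tau e)%R = \sum_(z in Z') dis z)%N.
  move=> Ae; rewrite [RHS](reindex_inj (addIr (spread tau e))) /=.
  by apply: eq_bigl => z; rewrite Z'_spread.
have double : (#|Z'| * #|A| <= 4 * (#|A| * \sum_(z in Z') dis z))%N.
  have -> : (#|A| * \sum_(z in Z') dis z =
     \sum_(z in Z') \sum_(e in A) dis (z + spread tau e)%R)%N.
    rewrite exchange_big /= -sum_nat_const; apply: eq_bigr => e Ae.
    by rewrite swap.
  rewrite -sum_nat_const big_distrr /=; apply: leq_sum => z Z'z.
  have := no_few ((tau, tau'), (i, z)); rewrite /few_tests /= inj_tau /=.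
  move: Z'z; rewrite inE => -> /=; rewrite -leqNgt => /leq_trans; apply.
  rewrite leq_mul2l /= -sum1_card big_mkcondr /=.
  by apply: leq_sum => e _; rewrite /dis; case: (_ != _).
have le_dis : (\sum_(z in Z') dis z <= #|dis|)%N.
  rewrite -sum1_card [leqRHS]big_mkcond [leqLHS]big_mkcond /=.
  by apply: leq_sum => z _; rewrite [z \in dis]inE; case: ifP => // _; case: (dis z).
rewrite -(leq_pmul2r A_gt0).
apply: (leq_trans (leq_mul half (leqnn _))); rewrite -mulnA.
apply: (leq_trans (leq_mul (leqnn 2) double)).
rewrite (mulnC #|A|) !mulnA leq_mul2r -[(2 * 4)%N]/8%N.
by rewrite leq_mul2l /= le_dis orbT.
Qed.

Lemma card_few_tests (F : realFieldType) tau tau' i z : (5 <= k)%N ->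
  #|[pred c : boolfun k | few_tests c tau tau' i z]|%:R
    <= 2^-1 ^+ (2 ^ (k - 5)) * #|{: boolfun k}|%:R :> F.
Proof.
(* A block of eight directions: two disagreements are allowed, and eight coins are tossed. *)
move=> k_ge5; have num : 2 ^+ 2 * (3 / 4) ^+ 8 <= 2^-1 :> F by lra.
case: (boolP (injectiveb (fun j => (tau j).1) &&
    (cand_point tau z i != cand_point tau' z i))); last first.
  move=> nP; rewrite eq_card0 ?mulr_ge0 ?exprn_ge0 ?invr_ge0 // => c.
  by rewrite inE /few_tests andbA (negPf nP).
case/andP => inj_tau ne_i; have tau_inj := injectiveP _ inj_tau.
set A := free_dirs tau (tau i).1 (tau' i).1.
have [r le_k_r cardA] := card_free_dirs (tau i).1 (tau' i).1 tau_inj.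
pose phi e := cand_point tau (z + spread tau e).
pose psi e := cand_point tau' (z + spread tau e).
have phi_inj : {in A &, injective phi}.
  by move=> e e' _ _; rewrite /phi !cand_point_spread // => /addrI.
have disj : {in A &, forall e e', phi e != psi e'}.
  move=> e e' Ae Ae'; apply: contraNneq ne_i => /(congr1 (fun u : cube k => u i)).
  by rewrite (cand_point_free _ Ae) ?(cand_point_free _ Ae') ?inE ?eqxx ?orbT // => ->.
have le_few := few_disagreements F (2 ^ (r - 2)) phi_inj disj.
apply: (le_trans (le_trans _ le_few)).
  rewrite ler_nat; apply: subset_leq_card; apply/subsetP => c.
  rewrite !inE => /and3P[_ _]; rewrite cardA -(@subnK 2 r); last by lia.
  by rewrite addnK expnD mulnC ltn_pmul2r // => /ltnW.
rewrite ler_wpM2r // cardA.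
(* [A] splits into 2 ^ t blocks of eight, and k - 2 <= r gives k - 5 <= t. *)
have [t -> le_t] : exists2 t, r = (t + 3)%N & (k - 5 <= t)%N.
  by exists (r - 3)%N; lia.
have -> : (t + 3 - 2 = t + 1)%N by lia.
rewrite (_ : 2 ^ (t + 1) = 2 * 2 ^ t)%N; last by rewrite addn1 expnS.
rewrite (_ : 2 ^ (t + 3) = 8 * 2 ^ t)%N; last by rewrite expnD mulnC.
rewrite !exprM -exprMn.
apply: (le_trans (y := 2^-1 ^+ (2 ^ t))).
  apply: lerXn2r; rewrite ?nnegrE.
  - by rewrite mulr_ge0 ?exprn_ge0 ?divr_ge0.
  - by rewrite invr_ge0.
  exact: num.
by rewrite ler_wiXn2l ?invr_ge0 ?invf_le1 ?ler1n // leq_exp2l.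
Qed.

(** Union bound over two candidates, a coordinate and a labelling. The labellings alone number 2 ^
    #|T|, hence the need for a doubly exponentially small tail. *)
Lemma card_not_separating (F : realFieldType) : (5 <= k)%N ->
  #|[pred c : boolfun k | ~~ separating c]|%:R
    <= (#|cand| ^ 2 * (k * 2 ^ #|T|))%:R * 2^-1 ^+ (2 ^ (k - 5)) *
       #|{: boolfun k}|%:R :> F.
Proof.
move=> k_ge5.
pose P (t : (cand * cand) * ('I_k * {ffun T -> 'Z_2})) : pred (boolfun k) :=
  fun c => few_tests c t.1.1 t.1.2 t.2.1 t.2.2.
apply: (le_trans (y := (\sum_t #|P t|)%:R)).
  rewrite ler_nat; apply: leq_trans (card_exists_le P); apply: subset_leq_card.
  by apply/subsetP => c; rewrite !inE => /separating_few_tests.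
rewrite natr_sum -mulrA.
apply: (le_trans (y := \sum_t 2^-1 ^+ (2 ^ (k - 5)) * #|{: boolfun k}|%:R)).
  by apply: ler_sum => t _; apply: card_few_tests.
rewrite sumr_const.
have -> : #|{: (cand * cand) * ('I_k * {ffun T -> 'Z_2})}| =
    (#|cand| ^ 2 * (k * 2 ^ #|T|))%N.
  by rewrite !card_prod mulnn card_ord [#|{ffun T -> _}|]card_ffun card_ord.
by rewrite mulr_natl.
Qed.

End Candidates.

(** * Collisions, fibres and the tail over 32 j draws *)

Lemma card_collision (A B I : finType) (p : I -> A) : injective p ->
  (#|[pred h : {ffun A -> B} | ~~ injectiveb (fun i => h (p i))]| * #|B|
    <= #|I| ^ 2 * #|{ffun A -> B}|)%N.
Proof.
move=> p_inj.
pose P (ij : I * I) : pred {ffun A -> B} :=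
  fun h => (ij.1 != ij.2) && (h (p ij.1) == h (p ij.2)).
(* In a colliding [h] the value at [p ij.1] copies the one at [p ij.2], so overwriting it by any [b]
   loses no information. *)
have le_P ij : (#|P ij| * #|B| <= #|{ffun A -> B}|)%N.
  pose r (hb : {ffun A -> B} * B) : {ffun A -> B} :=
    [ffun a => if a == p ij.1 then hb.2 else hb.1 a].
  rewrite -cardX -(card_in_image (f := r)) ?max_card //.
  move=> [h b] [h' b'] /andP[/= /andP[ne /eqP hP] _] /andP[/= /andP[_ /eqP h'P] _].
  move=> /ffunP e; have eb : b = b' by have := e (p ij.1); rewrite !ffunE eqxx.
  have eh a : a != p ij.1 -> h a = h' a.
    by move=> /negPf na; have := e a; rewrite !ffunE na.
  congr (_, _) => //; apply/ffunP => a.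
  have [->|] := eqVneq a (p ij.1); last exact: eh.
  by rewrite hP h'P eh // (inj_eq p_inj) eq_sym.
apply: (leq_trans (n := (\sum_ij #|P ij|) * #|B|)).
  rewrite leq_mul2r; apply/orP; right; apply: leq_trans (card_exists_le P).
  apply: subset_leq_card; apply/subsetP => h; rewrite !inE.
  move=> /injectivePn[i [i' ne e]]; apply/existsP; exists (i, i').
  by rewrite /P /= ne e eqxx.
rewrite big_distrl /= -mulnn -card_prod -sum_nat_const.
exact: leq_sum.
Qed.

Lemma card_fibers_le (F : realFieldType) (A B : finType) (Q : A -> pred B) (b : F) :
  (forall a, #|Q a|%:R <= b) ->
  #|[pred x : A * B | Q x.1 x.2]|%:R <= #|A|%:R * b.
Proof.
move=> le_b; rewrite -sum1_card natr_sum.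
rewrite -(pair_big_dep xpredT Q (fun _ _ => 1%:R)) /=.
rewrite mulr_natl -sumr_const; apply: ler_sum => a _.
by apply: le_trans (le_b a); rewrite -sum1_card natr_sum.
Qed.

(** Here [d] of [z] labellings disagree, at least 1/8 of them, so each draw gains a factor 15/16.
    The 32 draws per unit of [j] pay for the factor 2 of [lower_tail] and still gain 1/2. *)
Lemma tail_base (F : realFieldType) (z d j : nat) : (z <= 8 * d)%N -> (d <= z)%N ->
  2 ^+ j * (z%:R - d%:R / 2) ^+ (32 * j) <= 2^-1 ^+ j * (z ^ (32 * j))%:R :> F.
Proof.
have num : 2 * (15 / 16) ^+ 32 <= 2^-1 :> F by lra.
rewrite -!(ler_nat F) natrM natrX !exprM -!exprMn => le_z le_d.
have d_ge0 : 0 <= d%:R :> F by [].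
set y : F := _%:R - _.
have y_ge0 : 0 <= y by rewrite /y; lra.
have y_le : y <= 15 / 16 * z%:R by rewrite /y; lra.
apply: lerXn2r; rewrite ?nnegrE.
- by rewrite mulr_ge0 ?exprn_ge0.
- by rewrite mulr_ge0 ?exprn_ge0 ?invr_ge0.
apply: (le_trans (y := 2 * (15 / 16 * z%:R) ^+ 32)).
  by rewrite ler_wpM2l // lerXn2r // nnegrE (le_trans y_ge0).
by rewrite exprMn mulrA ler_wpM2r ?exprn_ge0.
Qed.

(** * The algorithm and its three failure events *)

Section Algorithm.

Variables (k n s j : nat) (c : boolfun k).

Let T : finType := ('I_s * 'Z_2)%type.
Let cand : finType := {ffun 'I_k -> T * 'Z_2}.
Let m := (32 * j)%N.
(** [r.1.1] is the partition h and [r.1.2] the shift w, drawn once so that a single candidate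
    explains all answers; [r.2 t] is a fresh labelling for query [t]. *)
Let coins : finType :=
  ({ffun 'I_n -> 'I_s} * cube n * {ffun 'I_m -> {ffun T -> 'Z_2}})%type.

Definition query (r : coins) (x : cube n) (t : 'I_m) : cube n :=
  [ffun i => r.2 t (r.1.1 i, x i) + r.1.2 i].

(** [(tau i).1.2] is the bit of the input that [tau] claims at core variable [i]. *)
Definition guess (tau : cand) : 'Z_2 := c [ffun i => (tau i).1.2].

(* Two candidates accepted by this test disagree on at most a 1/32 fraction of
   the labellings drawn, far below the 1/8 guaranteed by [separating c]. *)
Definition decode (r : coins) (ans : seq 'Z_2) : 'Z_2 :=
  if [pick tau : cand | (64 * #|[pred t : 'I_m |
        nth 0%R ans t != c (cand_point tau (r.2 t))]| <= m)%N] is Some tau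
  then guess tau else 0.

Variables (p : 'I_k -> 'I_n) (g : boolfun n) (x : cube n).

Definition true_cand (hw : {ffun 'I_n -> 'I_s} * cube n) : cand :=
  [ffun i => ((hw.1 (p i), x (p i)), hw.2 (p i))].

(** The unknown function: [p] will be the junta embedding followed by the hidden permutation. *)
Let f (y : cube n) : 'Z_2 := c [ffun i => y (p i)].

(** Only rivals with some different label count, since equal labels give equal guesses. *)
Definition confusable (hw : {ffun 'I_n -> 'I_s} * cube n)
    (zs : {ffun 'I_m -> {ffun T -> 'Z_2}}) : bool :=
  injectiveb (fun i => (true_cand hw i).1) &&
  [exists tau : cand, [exists i, (true_cand hw i).1 != (tau i).1] &&
     (#|[pred t | c (cand_point (true_cand hw) (zs t)) !=
          c (cand_point tau (zs t))]| <= j)%N].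

Definition corrupted (r : coins) : {set 'I_m} :=
  [set t | g (query r x t) != f (query r x t)].

Lemma true_candE (r : coins) (t : 'I_m) :
  c (cand_point (true_cand r.1) (r.2 t)) = f (query r x t).
Proof. by congr (c _); apply/ffunP => i; rewrite !ffunE. Qed.

(** The true candidate errs exactly on the corrupted queries, so some candidate is accepted. An
    accepted one with a wrong guess would have a different label yet agree with the true one on most
    draws, making the coins confusable. *)
Lemma decode_correct (r : coins) :
  injective (fun i => r.1.1 (p i)) -> (64 * #|corrupted r| <= m)%N ->
  ~~ confusable r.1 r.2 ->
  decode r [seq g y | y <- [seq query r x t | t <- enum 'I_m]] = f x.
Proof.
move=> h_inj few_bad; rewrite negb_and /decode => not_conf.
have ansE (t : 'I_m) :
    nth 0 [seq g y | y <- [seq query r x t | t <- enum 'I_m]] t = g (query r x t).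
  by rewrite -map_comp (nth_map t) ?size_enum_ord // nth_ord_enum.
have tau_inj : injectiveb (fun i => (true_cand r.1 i).1).
  by apply/injectiveP => i i'; rewrite !ffunE => -[/h_inj].
move: not_conf; rewrite tau_inj /= => /existsPn not_conf.
have -> : f x = guess (true_cand r.1).
  by congr (c _); apply/ffunP => i; rewrite !ffunE.
case: pickP => [tau le_tau|/(_ (true_cand r.1))/negP[]]; last first.
  apply: leq_trans few_bad; rewrite leq_mul2l /=; apply: subset_leq_card.
  by apply/subsetP => t; rewrite !inE ansE true_candE.
apply/eqP/negP => /negP ne; move/negP: (not_conf tau); apply; apply/andP; split.
  apply: contraNT ne => /existsPn same; apply/eqP; congr (c _).
  by apply/ffunP => i; have /negPn/eqP := same i; rewrite !ffunE => <-.
set ans := [seq g y | y <- _] in ansE le_tau.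
pose err := [set t : 'I_m | nth 0 ans t != c (cand_point tau (r.2 t))].
have le_err : (64 * #|err| <= m)%N.
  apply: leq_trans le_tau; rewrite leq_mul2l /=; apply: subset_leq_card.
  by apply/subsetP => t; rewrite !inE.
have: (#|[pred t | c (cand_point (true_cand r.1) (r.2 t)) != c (cand_point tau (r.2 t))]|
    <= #|corrupted r| + #|err|)%N.
  apply: leq_trans (leq_card_setU _ _).1; apply: subset_leq_card; apply/subsetP => t.
  rewrite !inE ansE true_candE; case: (eqVneq (g _) (f _)) => [->|] //=.
(* Each of the two sets has at most m / 64 = j / 2 elements. *)
move=> le_dis; apply: leq_trans le_dis _; move: few_bad le_err; rewrite /m.
by move: #|corrupted r| #|err| => a b; lia.
Qed.

Hypothesis p_inj : injective p.

Lemma card_coins : #|coins| = (#|{ffun 'I_n -> 'I_s}| * #|{: cube n}|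
  * #|{ffun 'I_m -> {ffun T -> 'Z_2}}|)%N.
Proof. by rewrite !card_prod. Qed.

Lemma card_not_injective :
  (#|[pred r : coins | ~~ injectiveb (fun i => r.1.1 (p i))]| * s
    <= k ^ 2 * #|coins|)%N.
Proof.
have := card_collision 'I_s p_inj; rewrite !card_ord => le_col.
rewrite card_coins !mulnA.
apply: leq_trans (leq_mul (leq_mul le_col (leqnn _)) (leqnn _)).
rewrite (mulnAC _ s) (mulnAC _ s) leq_mul2r; apply/orP; right.
rewrite -!cardX; apply: subset_leq_card; apply/subsetP => -[[h w] zs].
by rewrite !inE /= !andbT.
Qed.

(** For fixed h and labellings, the query is a translate of the uniform w. *)
Lemma card_query (P : pred (cube n)) (t : 'I_m) :
  (#|[pred r : coins | P (query r x t)]| * #|{: cube n}| <= #|P| * #|coins|)%N.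
Proof.
pose q (r : coins) : coins := ((r.1.1, query r x t), r.2).
have q_inj : injective q.
  move=> [[h w] zs] [[h' w'] zs'] [eh /ffunP e ez]; subst h' zs'; congr (_, _, _).
  by apply/ffunP => i; have := e i; rewrite !ffunE => /addrI.
have le_P : (#|[pred r : coins | P (query r x t)]| <=
    #|{ffun 'I_n -> 'I_s}| * #|P| * #|{ffun 'I_m -> {ffun T -> 'Z_2}}|)%N.
  rewrite -(card_image q_inj) -!cardX; apply: subset_leq_card.
  by apply/subsetP => _ /imageP[r Pr ->]; rewrite !inE /= andbT.
apply: leq_trans (leq_mul le_P (leqnn _)) _.
rewrite card_coins.
by apply: eq_leq; ring.
Qed.

(** Each query is uniform, so at most [b * m] corrupted ones are expected. Markov's inequality at m
    / 64 copes with the dependence of queries that share h and w. *)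
Lemma card_many_corrupted (F : realFieldType) (b : F) : (0 < j)%N ->
  #|[pred y | g y != f y]|%:R / #|{: cube n}|%:R <= b ->
  #|[pred r : coins | (m < 64 * #|corrupted r|)%N]|%:R <= 64 * b * #|coins|%:R.
Proof.
move=> j_gt0 le_b; have m_gt0 : (0 < m)%N by rewrite muln_gt0.
have W_gt0 : 0 < #|{: cube n}|%:R :> F by rewrite ltr0n card_ffun expn_gt0 card_ord.
pose B t := #|[pred r : coins | g (query r x t) != f (query r x t)]|.
have le_B t : (B t)%:R <= b * #|coins|%:R.
  have := card_query [pred y | g y != f y] t.
  rewrite -(ler_nat F) !natrM -ler_pdivlMr // => le_q.
  apply: le_trans le_q _; rewrite mulrAC.
  by rewrite ler_wpM2r.
have dbl : (\sum_(r : coins) #|corrupted r| = \sum_t B t)%N.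
  under eq_bigr => r _ do rewrite -sum1_card.
  under [RHS]eq_bigr => t _ do rewrite /B -sum1_card.
  rewrite (exchange_big_dep xpredT) //=; apply: eq_bigr => t _.
  by apply: eq_bigl => r; rewrite !inE.
have markov : (#|[pred r : coins | (m < 64 * #|corrupted r|)%N]| * m
    <= 64 * \sum_t B t)%N.
  rewrite -dbl -sum_nat_const big_distrr /= big_mkcond /=.
  by apply: leq_sum => r _; rewrite inE; case: ifP => // /ltnW.
rewrite -(@ler_pM2r _ m%:R) ?ltr0n // -natrM.
apply: (le_trans (y := (64 * \sum_t B t)%:R)); first by rewrite ler_nat.
rewrite natrM natr_sum -!mulrA ler_wpM2l //.
apply: (le_trans (y := \sum_(t < m) b * #|coins|%:R)).
  by apply: ler_sum => t _; apply: le_B.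
by rewrite sumr_const card_ord -(mulr_natr (b * _)) mulrA.
Qed.

(** For fixed h and w the true candidate is fixed and the labellings are independent, so
    [lower_tail] applies to each rival; a union bound over rivals follows. *)
Lemma card_confusable (F : realFieldType) : separating T c ->
  #|[pred r : coins | confusable r.1 r.2]|%:R
    <= #|cand|%:R * 2^-1 ^+ j * #|coins|%:R :> F.
Proof.
move=> sep.
pose Zs : finType := {ffun 'I_m -> {ffun T -> 'Z_2}}.
rewrite [#|coins|]card_prod natrM mulrCA.
apply: card_fibers_le => hw.
case: (boolP (injectiveb (fun i => (true_cand hw i).1))) => [inj|ninj]; last first.
  rewrite eq_card0 ?mulr_ge0 ?exprn_ge0 ?invr_ge0 // => zs.
  by rewrite inE /confusable (negPf ninj).
pose D (tau : cand) z := c (cand_point (true_cand hw) z) != c (cand_point tau z).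
pose P (tau : cand) : pred Zs := fun zs : {ffun 'I_m -> {ffun T -> 'Z_2}} =>
  [exists i, (true_cand hw i).1 != (tau i).1] &&
  (#|[pred t | D tau (zs t)]| <= j)%N.
have le_P (tau : cand) : #|P tau|%:R <= 2^-1 ^+ j * #|{: Zs}|%:R :> F.
  case: (boolP [exists i, (true_cand hw i).1 != (tau i).1]) => [/existsP[i ne]|ne];
    last first.
    rewrite eq_card0 ?mulr_ge0 ?exprn_ge0 ?invr_ge0 // => zs.
    by rewrite inE /P (negPf ne).
  move: sep => /forallP/(_ (true_cand hw))/forallP/(_ tau)/forallP/(_ i).
  rewrite inj ne /= => many.
  apply: (le_trans (y := #|[pred zs : Zs | (#|[pred t | D tau (zs t)]| <= j)%N]|%:R)).
    rewrite ler_nat; apply: subset_leq_card; apply/subsetP => zs; rewrite !inE.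
    by case/andP.
  apply: (le_trans (lower_tail F (fun _ => D tau) j)).
  rewrite prodr_const card_ord [#|{: Zs}|]card_ffun card_ord.
  by apply: tail_base => //; apply: max_card.
rewrite mulrC mulrA.
apply: (le_trans (y := (\sum_tau #|P tau|)%:R)).
  rewrite ler_nat; apply: leq_trans (card_exists_le P); apply: subset_leq_card.
  apply/subsetP => zs; rewrite !inE => /andP[_ /existsP[tau ?]].
  by apply/existsP; exists tau.
rewrite natr_sum; apply: (le_trans (y := \sum_(tau : cand) 2^-1 ^+ j * #|{: Zs}|%:R)).
  by apply: ler_sum => tau _; apply: le_P.
by rewrite sumr_const -(mulr_natl (_ * _)) -!mulrA [leRHS]mulrC -!mulrA.
Qed.

End Algorithm.

(** * Local correction for separating cores *)

Lemma separating_correctable (R : realType) (k n s j : nat) (c : boolfun k)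
    (v : 'I_k -> 'I_n) :
  injective v -> separating ('I_s * 'Z_2)%type c -> (0 < s)%N -> (0 < j)%N ->
  (16 * k ^ 2 <= s)%N -> (16 * (s * 4) ^ k <= 2 ^ j)%N ->
  nonadaptively_locally_correctable (1000%:R^-1 : R) (32 * j) (junta v c).
Proof.
move=> v_inj sep s_gt0 j_gt0 le_s le_j.
pose coins : finType := ({ffun 'I_n -> 'I_s} * cube n *
  {ffun 'I_(32 * j) -> {ffun 'I_s * 'Z_2 -> 'Z_2}})%type.
have coins_gt0 : 0 < #|coins|%:R :> R.
  by rewrite ltr0n !card_prod !card_ffun !card_ord !muln_gt0 !expn_gt0 s_gt0.
have w_ge0 (r : coins) : 0 <= #|coins|%:R^-1 :> R by rewrite invr_ge0.
have w_sum1 : \sum_(r : coins) #|coins|%:R^-1 = 1 :> R.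
  by rewrite sumr_const -(mulr_natl _^-1) divff // gt_eqF.
have size_q (r : coins) (x : cube n) :
    (size [seq query r x t | t <- enum 'I_(32 * j)] <= 32 * j)%N.
  by rewrite size_map size_enum_ord.
exists (NonadaptiveAlg w_ge0 w_sum1 size_q (fun r _ ans => decode c r ans)).
move=> sigma g close_g x; set A := NonadaptiveAlg _ _ _ _.
pose p i := sigma (v i).
have p_inj : injective p by move=> i i' /perm_inj/v_inj.
have fE y : isomorph (junta v c) sigma y = c [ffun i => y (p i)].
  by rewrite !ffunE; congr (c _); apply/ffunP => i; rewrite !ffunE.
have le_bad : #|[pred y | g y != c [ffun i => y (p i)]]|%:R / #|{: cube n}|%:R
    <= 1000%:R^-1 :> R.
  apply: le_trans close_g; rewrite ler_wpM2r ?invr_ge0 // ler_nat.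
  by apply: eq_leq; apply: eq_card => y; rewrite !inE fE.
(* The failure events cost 1/16, 64/1000 and 1/16, together less than 1/3. *)
pose E1 := [pred r : coins | ~~ injectiveb (fun i => r.1.1 (p i))].
pose E2 := [pred r : coins | (32 * j < 64 * #|corrupted c p g x r|)%N].
pose E3 := [pred r : coins | confusable c p x r.1 r.2].
have le_E1 : #|E1|%:R <= 16^-1 * #|coins|%:R :> R.
  rewrite mulrC ler_pdivlMr // -natrM ler_nat.
  rewrite -(leq_pmul2r s_gt0) mulnAC.
  apply: leq_trans (leq_mul (card_not_injective s j p_inj) (leqnn 16)) _.
  by rewrite mulnAC (mulnC #|_|) leq_mul2r (mulnC _ 16%N) le_s orbT.
have le_E2 : #|E2|%:R <= 64 * 1000%:R^-1 * #|coins|%:R :> R.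
  exact: card_many_corrupted.
have le_E3 : #|E3|%:R <= 16^-1 * #|coins|%:R :> R.
  have le3 := card_confusable j p x R sep.
  apply: le_trans le3 _; rewrite ler_wpM2r //.
  rewrite card_ffun !card_prod !card_ord exprVn ler_pdivrMr ?exprn_gt0 //.
  rewrite mulrC ler_pdivlMr // -natrX -natrM ler_nat.
  by rewrite mulnC -mulnA.
have bad_run (r : coins) : run g x (r : seed A) != isomorph (junta v c) sigma x ->
    [|| E1 r, E2 r | E3 r].
  apply: contraR; rewrite !negb_or => /and3P[/negPn/injectiveP h_inj few nconf].
  rewrite /run /= fE; apply/eqP; apply: (decode_correct h_inj _ nconf).
  by rewrite leqNgt.
pose good (r : coins) := run g x (r : seed A) == isomorph (junta v c) sigma x.
have split_sum : 1 = prob_output A g x (isomorph (junta v c) sigma x)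
    + \sum_(r : coins | ~~ good r) #|coins|%:R^-1 :> R.
  by rewrite -[LHS]w_sum1 (bigID good).
have le_fail : \sum_(r : coins | ~~ good r) #|coins|%:R^-1
    <= (#|E1|%:R + #|E2|%:R + #|E3|%:R) / #|coins|%:R :> R.
  rewrite sumr_const -(mulr_natl _^-1) ler_wpM2r ?invr_ge0 // -!natrD ler_nat.
  rewrite -(cardsE E1) -(cardsE E2) -(cardsE E3) -addnA.
  apply: leq_trans (leq_add (leqnn _) (leq_card_setU _ _).1).
  apply: leq_trans (leq_card_setU _ _).1; apply: subset_leq_card.
  by apply/subsetP => r /bad_run; rewrite !inE.
have : (#|E1|%:R + #|E2|%:R + #|E3|%:R) / #|coins|%:R <= 3^-1 :> R.
  rewrite ler_pdivrMr //; move: le_E1 le_E2 le_E3 coins_gt0; clear.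
  move: (#|E1|%:R : R) (#|E2|%:R : R) (#|E3|%:R : R) (#|coins|%:R : R).
  by move=> a b d e; lra.
move: le_fail split_sum; move: (prob_output _ _ _ _) (\sum_(_ | _) _); move: (_ / _).
by clear=> a b d le_d eq_ad le_a; lra.
Qed.

(** * Numerical estimates *)

Lemma sqr_le_expn (d : nat) : ((20 + d) ^ 2 <= 2 ^ (9 + d))%N.
Proof.
elim: d => // d IH; rewrite !addnS [leqRHS]expnS.
apply: leq_trans (leq_mul (leqnn 2) IH); move: (20 + d)%N (leq_addr d 20) => a.
nia.
Qed.

Lemma trunc_log_lt (k : nat) : (2 <= k)%N -> (trunc_log 2 k < k)%N.
Proof.
move=> k_ge2; have := trunc_logP (isT : 1 < 2)%N (ltnW k_ge2).
by apply: leq_trans; apply: ltn_expl.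
Qed.

Lemma ln_ge_trunc_log (R : realType) (k : nat) : (2 <= k)%N ->
  (trunc_log 2 k)%:R / 2 <= ln (k%:R : R).
Proof.
move=> k_ge2.
have ln2 : 2^-1 <= ln 2 :> R.
  have := @le_ln1Dx R (- 2^-1) ltac:(lra).
  rewrite (_ : 1 - 2^-1 = 2^-1); last by lra.
  by rewrite lnV ?posrE //; lra.
have le_k : (2 : R) ^+ trunc_log 2 k <= k%:R.
  by rewrite -natrX ler_nat trunc_logP // ltnW.
have := le_k; rewrite -ler_ln ?posrE ?exprn_gt0 ?ltr0n ?(ltnW k_ge2) //.
rewrite lnXn //; apply: le_trans; rewrite -(mulr_natl (ln _)).
by rewrite ler_wpM2l.
Qed.

(** The summands are the exponents of two candidate counts, of the bound 2 ^ k on the number of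
    coordinates, of the count of labellings, and of the desired decay 2 ^- k. *)
Lemma exponent_bound (k : nat) : (20 <= k)%N ->
  (4 * k * (trunc_log 2 k + 4) + k + 32 * k ^ 2 + k <= 2 ^ (k - 5))%N.
Proof.
move=> k_ge20; have lt_L : (trunc_log 2 k < k)%N by apply: trunc_log_lt; lia.
apply: (leq_trans (n := 64 * k ^ 2)); first by nia.
(* This bounds k ^ 2 by 2 ^ (k - 11), and 64 = 2 ^ 6 brings the exponent to k - 5. *)
have := sqr_le_expn (k - 20); rewrite subnKC // => le_sq.
apply: leq_trans (leq_mul (leqnn 64) le_sq) _.
by rewrite -[64%N]/(2 ^ 6)%N -expnD leq_exp2l //; lia.
Qed.

(** Each core variable has s * 2 * 2 = (8 k) ^ 2 options when s = 16 k ^ 2, and k < 2 ^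
    ([trunc_log 2 k] + 1). *)
Lemma cand_bound (k : nat) : (2 <= k)%N ->
  ((16 * k ^ 2 * 4) ^ k <= 2 ^ (2 * k * (trunc_log 2 k + 4)))%N.
Proof.
move=> k_ge2; rewrite (_ : 16 * k ^ 2 * 4 = (8 * k) ^ 2)%N; last by ring.
rewrite -expnM [(2 * k * _)%N]mulnC [leqRHS]expnM leq_exp2r; last by lia.
rewrite -[8%N]/(2 ^ 3)%N.
have := trunc_log_ltn k (isT : 1 < 2)%N => /ltnW le_k.
by apply: leq_trans (leq_mul (leqnn _) le_k) _; rewrite -expnD leq_exp2l //; lia.
Qed.

(** * The density of exceptional cores *)

Lemma core_fraction_le (R : realType) (k : nat) (P : boolfun k -> Prop)
    (Q : pred (boolfun k)) (b : R) :
  (forall c, P c -> Q c) -> #|Q|%:R <= b * #|{: boolfun k}|%:R ->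
  core_fraction R P <= b.
Proof.
move=> PQ le_Q; rewrite /core_fraction ler_pdivrMr; last first.
  by rewrite ltr0n card_ffun expn_gt0 card_ord.
apply: le_trans le_Q; rewrite ler_nat; apply: subset_leq_card.
by apply/subsetP => c; rewrite inE => /asboolP; apply: PQ.
Qed.

Theorem theorem1p1 (R : realType) :
  exists (C : R) (delta : nat -> R),
    [/\ 0 < C, delta @ \oo --> 0 &
      forall n k : nat, (2 <= k)%N -> (k <= n)%N ->
      forall v : 'I_k -> 'I_n, (forall i j : 'I_k, (i < j)%N -> (v i < v j)%N) ->
      core_fraction R (fun c : boolfun k =>
        ~ exists2 q : nat, q%:R <= C * k%:R * ln (k%:R : R) ^+ 2 &
            nonadaptively_locally_correctable (1000%:R^-1 : R) q (junta v c))
        <= delta k].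
Proof.
(* The factor 2 ^+ 20 makes the bound trivial for k <= 20. *)
exists 1792, (geometric (2 ^+ 20) 2^-1); split => //.
  by apply: cvg_geometric; rewrite ger0_norm ?invr_ge0 // invf_lt1 // ltr1n.
move=> n k k_ge2 _ v v_incr; rewrite /geometric /=.
have v_inj : injective v.
  move=> i i' e; apply/val_inj; case: (ltngtP i i') => // /v_incr.
    by rewrite e ltnn.
  by rewrite e ltnn.
case: (leqP 20 k) => [k_ge20|/ltnW k_le20]; last first.
  apply: (core_fraction_le (Q := xpredT)) => //; rewrite ler_peMl //.
  rewrite -(subnKC k_le20) exprD mulrAC -exprMn divff ?pnatr_eq0 // expr1n mul1r.
  by rewrite exprn_ege1 // ler1n.
pose L := trunc_log 2 k; pose s := (16 * k ^ 2)%N.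
have L_gt0 : (0 < L)%N by rewrite trunc_log_gt0.
have s_gt0 : (0 < s)%N by rewrite muln_gt0 expn_gt0 (ltnW k_ge2).
have le_cand : ((s * 4) ^ k <= 2 ^ (2 * k * (L + 4)))%N by apply: cand_bound.
(* The exponent of the candidate count, plus 4 to make confusable coins have probability at most
   1/16. *)
pose j := (2 * k * (L + 4) + 4)%N.
apply: (core_fraction_le (Q := fun c => ~~ separating ('I_s * 'Z_2)%type c)).
  move=> c nP; apply/negP => sep; apply: nP; exists (32 * j)%N; last first.
    apply: (separating_correctable R v_inj sep) => //; first by rewrite /j addn4.
    by rewrite /j expnD mulnC leq_mul2r le_cand orbT.
  (* 32 j = 64 k L + 256 k + 128, and 64 + 256 + 128 = 448. *)
  have le_j : (32 * j <= 448 * (k * L ^ 2))%N by rewrite /j; nia.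
  apply: (le_trans (y := (448 * (k * L ^ 2))%:R)); first by rewrite ler_nat.
  have le_ln := ln_ge_trunc_log R k_ge2; rewrite -/L in le_ln.
  have le_sq : (L%:R / 2) ^+ 2 <= ln (k%:R : R) ^+ 2.
    by rewrite lerXn2r // nnegrE ?divr_ge0 // (le_trans _ le_ln) ?divr_ge0.
  (* Halving L to compare it with [ln k] costs a factor 4, and 1792 = 4 * 448. *)
  apply: (le_trans (y := 1792 * k%:R * (L%:R / 2) ^+ 2)).
    by rewrite 2!natrM natrX expr_div_n; lra.
  by rewrite ler_wpM2l // mulr_ge0.
apply: le_trans (card_not_separating _ R _) _; first by apply: leq_trans k_ge20.
rewrite ler_wpM2r //; set cnt := (_ * _)%N.
(* The union bound times 2 ^- (2 ^ (k - 5)) is thus at most 2 ^- k. *)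
have le_cnt : (cnt * 2 ^ k <= 2 ^ (2 ^ (k - 5)))%N.
  apply: leq_trans (leq_pexp2l _ (exponent_bound k_ge20)) => //.
  have cand_le : (#|{ffun 'I_k -> 'I_s * 'Z_2 * 'Z_2}| <= 2 ^ (2 * k * (L + 4)))%N.
    by rewrite card_ffun !card_prod !card_ord -mulnA.
  have k_le : (k <= 2 ^ k)%N by apply/ltnW/ltn_expl.
  rewrite /cnt -mulnn (_ : #|{: 'I_s * 'Z_2}| = 32 * k ^ 2)%N; last first.
    by rewrite card_prod !card_ord /s mulnAC.
  apply: leq_trans (leq_mul (leq_mul (leq_mul cand_le cand_le)
    (leq_mul k_le (leqnn _))) (leqnn _)) _.
  by rewrite -!expnD leq_exp2l // -/L; apply: eq_leq; ring.
have two_gt0 (a : nat) : 0 < 2 ^+ a :> R by rewrite exprn_gt0.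
rewrite !exprVn ler_pdivrMr // mulrAC ler_pdivlMr //.
apply: (le_trans (y := (2 ^ (2 ^ (k - 5)))%:R)).
  by rewrite -natrX -natrM ler_nat.
by rewrite natrX ler_peMl ?exprn_ge0 // exprn_ege1 // ler1n.
Qed.
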